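(* Let $n\ge1$ and let $x_1,\dots,x_n$ be distinct complex numbers. The two systems of linear equations in the variables $y_1,\dots,y_n$ (over $\mathbb{C}$) $$\sum_{i=1}^n x_i^r\,y_i=0,\qquad r=0,1,\dots,n-2,$$ and $$\sum_{1\le j\le n,\ j\ne i}\frac{y_i+y_j}{x_i-x_j}=0,\qquad i=1,\dots,n,$$ are equivalent, i.e. they have the same set of solutions. *)

(* Defs.v *)
From mathcomp Require Import all_boot all_order all_algebra.
From mathcomp Require Import reals.
From mathcomp Require Import complex.

(* Main.v *)
Require Import Defs.
From mathcomp Require Import all_boot all_order all_algebra.
From mathcomp Require Import reals.
From mathcomp Require Import complex.
From mathcomp Require Import ring zify.

(** Put [P_j = \prod_(k != j) ('X - x_k)] and [Q = \sum_j y_j P_j].  Both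
    systems say that [Q] is constant.  Indeed [Q^`()] takes at [x_i] the value
    [P_i(x_i)] times the left-hand side of the [i]-th equation of the second
    system, and [Q^`()] has degree less than [n].  For the first system, let
    [Q_r = \sum_j x_j^r y_j P_j] and [s_r = \sum_j x_j^r y_j]; then
    [Q_(r+1) = 'X Q_r - s_r P] with [P = \prod_k ('X - x_k)], and [s_r] is the
    coefficient of degree [n - 1] of [Q_r]. *)

Import GRing.Theory Num.Theory.
Local Open Scope ring_scope.

Section NodePolynomials.

Variables (F : numFieldType) (n : nat) (x : 'I_n -> F).

Definition node_poly : {poly F} := \prod_k ('X - (x k)%:P).
Definition conode_poly (j : 'I_n) : {poly F} :=
  \prod_(k | k != j) ('X - (x k)%:P).
Definition lagrange_comb (y : 'I_n -> F) : {poly F} :=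
  \sum_j y j *: conode_poly j.

Lemma node_polyE j : node_poly = ('X - (x j)%:P) * conode_poly j.
Proof. by rewrite /node_poly (bigD1 j). Qed.

Lemma conode_poly_monic j : conode_poly j \is monic.
Proof. by apply: monic_prod => k _; apply: monicXsubC. Qed.

Lemma size_conode_poly j : size (conode_poly j) = n.
Proof.
rewrite /conode_poly size_prod => [|k _]; last by rewrite polyXsubC_eq0.
rewrite (eq_bigr (fun=> 2)) => [|k _]; last by rewrite size_XsubC.
rewrite sum_nat_const cardC1 card_ord.
by case: n j => [[]//|m] j /=; rewrite muln2 -addnn -addSn addnK.
Qed.

Lemma size_lagrange_comb y : (size (lagrange_comb y) <= n)%N.
Proof.
apply: (leq_trans (size_sum _ _ _)); apply/bigmax_leqP => j _.
by rewrite (leq_trans (size_scale_leq _ _)) // size_conode_poly.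
Qed.

Lemma lagrange_comb_top y : (lagrange_comb y)`_n.-1 = \sum_j y j.
Proof.
rewrite coef_sum; apply: eq_bigr => j _.
have /monicP := conode_poly_monic j.
by rewrite coefZ lead_coefE size_conode_poly => ->; rewrite mulr1.
Qed.

(** Write [x j] as ['X - ('X - x j)]: the last factor turns [conode_poly j] into [node_poly], the
    same for all [j]. *)
Lemma lagrange_comb_shift y :
  lagrange_comb (fun j => x j * y j)
  = 'X * lagrange_comb y - (\sum_j y j) *: node_poly.
Proof.
rewrite /lagrange_comb mulr_sumr scaler_suml -sumrB; apply: eq_bigr => j _.
rewrite (node_polyE j) -!mul_polyC mulrBl polyCM; ring.
Qed.

Lemma lagrange_comb_power y m :
    (forall r, (r < m)%N -> \sum_j x j ^+ r * y j = 0) ->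
  lagrange_comb (fun j => x j ^+ m * y j) = 'X^m * lagrange_comb y.
Proof.
elim: m => [|m IHm] s0.
  by rewrite mul1r; apply: eq_bigr => j _; rewrite mul1r.
transitivity (lagrange_comb (fun j => x j * (x j ^+ m * y j))).
  by apply: eq_bigr => j _; rewrite exprS mulrA.
rewrite (lagrange_comb_shift (fun j => x j ^+ m * y j)) s0 // scale0r subr0.
by rewrite IHm ?mulrA -?exprS // => r lt_rm; apply: s0; apply: ltnW.
Qed.

(** If the moments vanish, ['X^(n.-1) * Q] is again a combination of the [conode_poly j], hence of
    size at most [n], which leaves room only for a constant [Q]. *)
Lemma moments0P y :
  (forall r, (r < n.-1)%N -> \sum_j x j ^+ r * y j = 0)
  <-> (size (lagrange_comb y) <= 1)%N.
Proof.
split=> [s0|szQ].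
  have [->|Q_neq0] := eqVneq (lagrange_comb y) 0; first by rewrite size_poly0.
  have := size_lagrange_comb (fun j => x j ^+ n.-1 * y j).
  rewrite lagrange_comb_power // mulrC size_mulXn // => szQn.
  by move: szQn; case: (n) => [|m] /=; lia.
(* Strong induction: [lagrange_comb_power] at exponent [r] needs all lower moments to vanish. *)
elim/ltn_ind=> r IHr lt_r.
rewrite -(lagrange_comb_top (fun j => x j ^+ r * y j)).
rewrite lagrange_comb_power => [|k lt_kr]; last first.
  by apply: IHr => //; apply: ltn_trans lt_r.
(* This is the coefficient of [Q] of degree [n.-1 - r], which is positive. *)
by rewrite coefXnM ltnNge ltnW // nth_default // (leq_trans szQ) // subn_gt0.
Qed.

Hypothesis x_inj : injective x.

Lemma conode_poly_neq0 i : (conode_poly i).[x i] != 0.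
Proof.
rewrite horner_prod; apply/prodf_neq0 => k k_neq_i.
by rewrite hornerXsubC subr_eq0 (inj_eq x_inj) eq_sym.
Qed.

Lemma horner_conode_poly_neq i j : j != i -> (conode_poly j).[x i] = 0.
Proof.
move=> j_neq_i; rewrite horner_prod (bigD1 i) 1?eq_sym //=.
by rewrite hornerXsubC subrr mul0r.
Qed.

(* Evaluate at [x i] the derivative of [('X - x_j) P_j = ('X - x_i) P_i]. *)
Lemma deriv_conode_poly_neq i j : j != i ->
  (conode_poly j)^`().[x i] = (conode_poly i).[x i] / (x i - x j).
Proof.
move=> j_neq_i.
have := congr1 (fun p => p^`().[x i]) (etrans (esym (node_polyE j)) (node_polyE i)).
rewrite !derivM !derivXsubC !mul1r !hornerE subrr mul0r addr0.
rewrite horner_conode_poly_neq // add0r => <-.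
by rewrite mulrC mulKf // subr_eq0 (inj_eq x_inj) eq_sym.
Qed.

(** Logarithmic derivative of the product, obtained by building the product and the sum of inverses
    in parallel. *)
Lemma deriv_conode_poly i :
  (conode_poly i)^`().[x i]
  = (conode_poly i).[x i] * \sum_(j | j != i) (x i - x j)^-1.
Proof.
rewrite /conode_poly.
elim/big_rec2: _ => [|j s p j_neq_i IHp]; first by rewrite derivC horner0 mulr0.
rewrite derivM derivXsubC mul1r !hornerE IHp.
have : x i - x j != 0 by rewrite subr_eq0 (inj_eq x_inj) eq_sym.
by move=> ?; field.
Qed.

(** In each term, the [y i] part comes from the derivative of [conode_poly i], the [y j] part from
    that of [conode_poly j]. *)
Lemma deriv_lagrange_comb y i :
  (lagrange_comb y)^`().[x i]
  = (conode_poly i).[x i] * \sum_(j | j != i) (y i + y j) / (x i - x j).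
Proof.
rewrite /lagrange_comb raddf_sum horner_sum (bigD1 i) //=.
rewrite derivZ hornerZ deriv_conode_poly !mulr_sumr -big_split /=.
apply: eq_bigr => j j_neq_i.
by rewrite derivZ hornerZ deriv_conode_poly_neq //; ring.
Qed.

Lemma pairwise_system0P y :
  (forall i, \sum_(j | j != i) (y i + y j) / (x i - x j) = 0)
  <-> (size (lagrange_comb y) <= 1)%N.
Proof.
split=> [eq0|szQ i]; last first.
  apply: (mulfI (conode_poly_neq0 i)).
  by rewrite -deriv_lagrange_comb (size1_polyC szQ) derivC horner0 mulr0.
have dQ0 : (lagrange_comb y)^`() = 0.
  apply: (@roots_geq_poly_eq0 _ _ (map x (enum 'I_n))).
  - by apply/allP => _ /mapP[i _ ->]; rewrite /root deriv_lagrange_comb eq0 mulr0.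
  - by rewrite map_inj_uniq ?enum_uniq.
  - rewrite size_map size_enum_ord (leq_trans (size_poly _ _)) //.
    by rewrite (leq_trans (leq_pred _)) // size_lagrange_comb.
(* Characteristic zero enters here: coefficient [k] of the derivative is [k.+1] times coefficient
   [k.+1] of [Q]. *)
apply/leq_sizeP => -[|k] // _; apply/eqP.
by have /eqP := coef_deriv (lagrange_comb y) k; rewrite dQ0 coef0 eq_sym mulrn_eq0.
Qed.

End NodePolynomials.

Theorem theorem0p6p2 (R : realType) (n : nat) (hn : (1 <= n)%N)
    (x : 'I_n -> R[i]) (hx : injective x) (y : 'I_n -> R[i]) :
  (forall r : 'I_(n - 1), \sum_(i < n) x i ^+ r * y i = 0)
  <->
  (forall i : 'I_n, \sum_(j < n | j != i) (y i + y j) / (x i - x j) = 0).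
Proof.
rewrite pairwise_system0P // -moments0P -subn1.
split=> [s0 r lt_r|s0 r]; last exact: s0.
exact: (s0 (Ordinal lt_r)).
Qed.
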